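(* Consider a utility-adjustable networked game with player set $N=\{1,\dots,n\}$, strategy sets $S_i=\{1,\dots,k_i\}$, neighbor sets $U(i)\subset N$, and a system objective function $\phi:S=\prod_{i=1}^n S_i\to\mathbb{R}$ with structure vector $V^{\phi}\in\mathbb{R}^{k}$ (a row vector), i.e. $\phi(x)=V^{\phi}\,(x_1\otimes x_2\otimes\cdots\otimes x_n)$ in vector form, where $k=\prod_{i=1}^n k_i$. For each $i\in N$ let $N_i=U(i)\cup\{i\}$, $k_{N_i}=\prod_{j\in N_i}k_j$, $k_{-i}=\prod_{j\ne i}k_j$, and $T_i=[\Gamma_{N_i}^{\mathrm T},\ \Gamma_{-i}^{\mathrm T}]$. Then local information based utility functions can be designed for $\phi$ if and only if, for every $i\in N$, the linear equation $$T_i\,\xi_i=(V^{\phi})^{\mathrm T}$$ has a solution $\xi_i=[(\xi_i^1)^{\mathrm T},(\xi_i^2)^{\mathrm T}]^{\mathrm T}$ with $\xi_i^1\in\mathbb{R}^{k_{N_i}}$ and $\xi_i^2\in\mathbb{R}^{k_{-i}}$. Moreover, if solutions $\xi_i$ exist for all $i\in N$, then the local information based utility functions are given by $$c_i(x)=(\xi_i^1)^{\mathrm T}\,\Gamma_{N_i}\,(x_1\otimes x_2\otimes\cdots\otimes x_n),\qquad \forall i\in N.$$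
   Context: Vector form: a strategy $x_i=a\in S_i=\{1,\dots,k_i\}$ is identified with the column vector $\delta_{k_i}^a$, the $a$-th column of the identity matrix $I_{k_i}$. Every function $f:S\to\mathbb{R}$ has a unique structure vector $M_f\in\mathbb{R}^{k}$ (row vector) with $f(x_1,\dots,x_n)=M_f(x_1\otimes\cdots\otimes x_n)$. (For column vectors the semi-tensor product is the Kronecker product $\otimes$.) Products over index sets are taken in increasing order of the indices. Drawing matrix: for $U\subset N$, $\Gamma_U:=\gamma_1\otimes\gamma_2\otimes\cdots\otimes\gamma_n$, where $\gamma_i=I_{k_i}$ if $i\in U$ and $\gamma_i=\mathbf{1}_{k_i}^{\mathrm T}$ (the all-ones row vector of length $k_i$) otherwise. Thus $\Gamma_U(x_1\otimes\cdots\otimes x_n)=\bigotimes_{j\in U}x_j$. Also $\Gamma_{-i}:=\Gamma_{N\setminus\{i\}}$. Networked game: $U(i)$ is the set of neighbors of player $i$ (the players with which $i$ can communicate). ''Utility-adjustable'' means that the players, strategy sets, neighbor sets and $\phi$ are fixed while the utility functions $c_i:S\to\mathbb{R}$ are to be chosen. Potential game: a finite game with utilities $c_i:S\to\mathbb{R}$ is a potential game with potential function $P:S\to\mathbb{R}$ if for every $i\in N$, every $s^{-i}\in\prod_{j\neq i}S_j$ and all $x_i,y_i\in S_i$, $c_i(x_i,s^{-i})-c_i(y_i,s^{-i})=P(x_i,s^{-i})-P(y_i,s^{-i})$. ''Local information based utility functions can be designed'' means: there exist utility functions $c_i:S\to\mathbb{R}$, $i\in N$, such that each $c_i(x)$ depends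 only on the strategies $x_j$ with $j\in N_i=U(i)\cup\{i\}$, and the resulting game is a potential game whose potential function is $\phi$. Such $c_i$ are called local information based utility functions. *)

(* Defs.v *)
From HB Require Import structures.
From mathcomp Require Import all_boot all_order all_algebra.
From mathcomp Require Export reals.
From mathcomp.real_closed Require Export mxtens.

Set Implicit Arguments.
Unset Strict Implicit.
Unset Printing Implicit Defensive.

Import Order.TTheory GRing.Theory Num.Theory.
Local Open Scope ring_scope.

(* kron A = A_0 ⊗ A_1 ⊗ ... ⊗ A_{n-1}, the factors in increasing order of the
   index; the casts only rewrite the dimensions with big_ord0/big_ord_recl. *)
Fixpoint kron (R : pzRingType) (n : nat) :
    forall (p q : 'I_n -> nat) (A : forall i, 'M[R]_(p i, q i)),
    'M[R]_(\prod_(i < n) p i, \prod_(i < n) q i) :=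
  match n with
  | 0 => fun p q _ =>
      castmx (esym (big_ord0 _ _ _ _), esym (big_ord0 _ _ _ _))
        (1%:M : 'M[R]_1)
  | n'.+1 => fun p q A =>
      castmx (esym (big_ord_recl _ _), esym (big_ord_recl _ _))
        (A ord0 *t kron (fun i : 'I_n' => A (lift ord0 i)))
  end.

(* The player set is 'I_n, and S_i = {1, ..., k_i} is represented by 'I_(k i)
   (strategies are numbered from 0). *)
Definition profile (n : nat) (k : 'I_n -> nat) : Type :=
  {dffun forall i : 'I_n, 'I_(k i)}.

(* (a, s^{-i}); the i-th component of s is discarded. *)
Definition play (n : nat) (k : 'I_n -> nat) (s : profile k) (i : 'I_n)
    (a : 'I_(k i)) : profile k :=
  [ffun j : 'I_n => (dfwith s a j : 'I_(k j))].

Section VectorForm.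
Variables (R : realType) (n : nat) (k : 'I_n -> nat).

Definition strategy_vec (m : nat) (a : 'I_m) : 'cV[R]_m := delta_mx a 0.

(* x_1 ⊗ ... ⊗ x_n; the cast rewrites the number of columns
   1 * ... * 1 into 1. *)
Definition profile_vec (x : profile k) : 'cV[R]_(\prod_(i < n) k i) :=
  castmx (erefl _, big1_eq _ _)
    (kron (fun i : 'I_n => strategy_vec (x i))).

Definition is_structure_vector (f : profile k -> R)
    (M : 'rV[R]_(\prod_(i < n) k i)) : Prop :=
  forall x : profile k, f x = (M *m profile_vec x) 0 0.

Definition drawing_factor (U : {set 'I_n}) (i : 'I_n) :
    'M[R]_(if i \in U then k i else 1%N, k i) :=
  if i \in U as b return 'M[R]_(if b then k i else 1%N, k i)
  then 1%:M else const_mx 1.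

(* The cast rewrites the number of rows with big_mkcond. *)
Definition drawing_matrix (U : {set 'I_n}) :
    'M[R]_(\prod_(i in U) k i, \prod_(i < n) k i) :=
  castmx (esym (big_mkcond _ _), erefl _) (kron (drawing_factor U)).

End VectorForm.

Definition is_potential_game (R : realType) (n : nat) (k : 'I_n -> nat)
    (c : 'I_n -> profile k -> R) (P : profile k -> R) : Prop :=
  forall (i : 'I_n) (s : profile k) (a b : 'I_(k i)),
    c i (play s a) - c i (play s b) = P (play s a) - P (play s b).

Definition depends_only_on (R : realType) (n : nat) (k : 'I_n -> nat)
    (A : {set 'I_n}) (f : profile k -> R) : Prop :=
  forall x y : profile k, (forall j, j \in A -> x j = y j) -> f x = f y.

Section NetworkedGame.
Variables (R : realType) (n : nat) (k : 'I_n -> nat) (U : 'I_n -> {set 'I_n}).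

Definition closed_nbhd (i : 'I_n) : {set 'I_n} := i |: U i.

Definition local_info_utilities (phi : profile k -> R)
    (c : 'I_n -> profile k -> R) : Prop :=
  (forall i, depends_only_on (closed_nbhd i) (c i)) /\ is_potential_game c phi.

Definition local_info_designable (phi : profile k -> R) : Prop :=
  exists c : 'I_n -> profile k -> R, local_info_utilities phi c.

Definition T_mx (i : 'I_n) :
    'M[R]_(\prod_(j < n) k j,
           \prod_(j in closed_nbhd i) k j + \prod_(j in [set~ i]) k j) :=
  row_mx (drawing_matrix R k (closed_nbhd i))^T (drawing_matrix R k [set~ i])^T.

End NetworkedGame.

(* Main.v *)
Require Import Defs.
From mathcomp Require Import all_boot all_order all_algebra.
From mathcomp Require Import lra.

Set Implicit Arguments.
Unset Strict Implicit.
Unset Printing Implicit Defensive.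

Import GRing.Theory.
Local Open Scope ring_scope.

(* Gamma_U maps x_1 ⊗ ... ⊗ x_n to the basis vector indexed by the restriction
   of x to U, so the row vectors xi^T Gamma_U represent exactly the functions
   of (x_j)_{j in U}.  Hence T_i xi_i = V^T says that phi splits as a function
   of the strategies in N_i plus a function of the strategies of the players
   other than i.  On the other hand, c_i satisfies the potential equations of
   player i exactly when phi - c_i does not depend on x_i. *)

(** Mixed-radix position of the entry 1 in a Kronecker product of basis vectors. Recursion and casts
    mirror those of [kron], so that both unfold together. *)
Fixpoint kron_index (n : nat) :
    forall (p : 'I_n -> nat), (forall i, 'I_(p i)) -> 'I_(\prod_(i < n) p i) :=
  match n with
  | 0 => fun p _ => cast_ord (esym (big_ord0 _ _ _ _)) ord0
  | n'.+1 => fun p e =>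
      cast_ord (esym (big_ord_recl _ _))
        (mxtens_index (e ord0, kron_index (fun i : 'I_n' => e (lift ord0 i))))
  end.

Lemma kron_index_inj n (p : 'I_n -> nat) (e e' : forall i, 'I_(p i)) :
  kron_index e = kron_index e' <-> forall i, e i = e' i.
Proof.
elim: n p e e' => [|n IHn] p e e'.
  by split=> [_ []//|_].
split=> [/cast_ord_inj /(can_inj (@mxtens_indexK _ _)) [e0 eS] i | eq_e].
  have [j ->|->] := unliftP ord0 i; last exact: e0.
  exact: (proj1 (IHn _ _ _) eS).
rewrite /= eq_e; congr (cast_ord _ (mxtens_index (_, _))).
by apply/IHn.
Qed.

Section Kron.
Variable R : comPzRingType.

(** The inner dimension may be cast along two different proofs; equality proofs on [nat] are
    irrelevant, so they can be identified. *)
Lemma mul_castmx m m' n n' p p' (em : m = m') (en en' : n = n') (ep : p = p')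
    (A : 'M[R]_(m, n)) (B : 'M[R]_(n, p)) :
  castmx (em, en) A *m castmx (en', ep) B = castmx (em, ep) (A *m B).
Proof.
rewrite (eq_irrelevance en' en).
by case: _ / em; case: _ / en; case: _ / ep; rewrite !castmx_id.
Qed.

Lemma kron_mul n (p q r : 'I_n -> nat) (A : forall i, 'M[R]_(p i, q i))
    (B : forall i, 'M[R]_(q i, r i)) :
  kron A *m kron B = kron (fun i => A i *m B i).
Proof.
elim: n p q r A B => [|n IHn] p q r A B /=; rewrite mul_castmx.
  by rewrite mulmx1.
by rewrite tensmx_mul IHn.
Qed.

Lemma eq_kron n (p q : 'I_n -> nat) (A B : forall i, 'M[R]_(p i, q i)) :
  (forall i, A i = B i) -> kron A = kron B.
Proof.
elim: n p q A B => [//|n IHn] p q A B eqAB /=.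
by rewrite eqAB (IHn _ _ _ _ (fun i => eqAB (lift ord0 i))).
Qed.

Lemma kron_delta n (p q : 'I_n -> nat) (e : forall i, 'I_(p i))
    (f : forall i, 'I_(q i)) :
  kron (fun i => delta_mx (e i) (f i) : 'M[R]_(p i, q i))
    = delta_mx (kron_index e) (kron_index f).
Proof.
elim: n p q e f => [|n IHn] p q e f.
  apply/matrixP=> i j; rewrite castmxE !mxE.
  rewrite [cast_ord _ i]ord1 [cast_ord _ j]ord1.
  have -> : i = kron_index e.
    by apply: (@cast_ord_inj _ _ (big_ord0 _ _ _ _)); rewrite !ord1.
  have -> : j = kron_index f.
    by apply: (@cast_ord_inj _ _ (big_ord0 _ _ _ _)); rewrite !ord1.
  by rewrite !eqxx.
rewrite /= IHn; apply/matrixP=> i j; rewrite castmxE !mxE !esymK.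
(* Undoing the casts exposes each index as a pair (head, tail), on which the entries of the tensor
   product factor. *)
set i' := cast_ord _ i; set j' := cast_ord _ j.
have -> : i = cast_ord (esym (big_ord_recl _ _)) i' by rewrite cast_ordK.
have -> : j = cast_ord (esym (big_ord_recl _ _)) j' by rewrite cast_ordK.
rewrite !(inj_eq (@cast_ord_inj _ _ _)).
case: (mxtens_indexP i') => i0 i1; case: (mxtens_indexP j') => j0 j1.
rewrite !mxtens_indexK !(inj_eq (can_inj (@mxtens_indexK _ _))) !xpair_eqE /=.
by rewrite -natrM mulnb andbACA.
Qed.

End Kron.

Section Drawing.
Variables (R : realType) (n : nat) (k : 'I_n -> nat).
Implicit Types (x y s : profile k) (A : {set 'I_n}).

Definition profile_index x : 'I_(\prod_(i < n) k i) :=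
  kron_index (fun i => x i).

Lemma profile_vecE x : profile_vec R x = delta_mx (profile_index x) 0.
Proof.
rewrite /profile_vec (kron_delta _ _ (fun=> ord0)).
apply/colP=> i; rewrite castmxE !mxE cast_ord_id [in RHS]eqxx.
congr ((_ && _)%:R); rewrite -(inj_eq (@cast_ord_inj _ _ (big1_eq _ _))).
by rewrite !ord1.
Qed.

Lemma profile_index_inj : injective profile_index.
Proof. by move=> x y /kron_index_inj eq_xy; apply/ffunP. Qed.

(** An injection between finite sets of the same cardinality, the product of the [k i], is onto. *)
Lemma profile_index_surj a : exists x, profile_index x = a.
Proof.
have /codomP[x ->] : a \in codom profile_index; last by exists x.
apply: inj_card_onto; first exact: profile_index_inj.
rewrite card_ord card_dep_ffun foldrE big_map big_enum /=.
by under [leqRHS]eq_bigr do rewrite card_ord.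
Qed.

(** Profile vectors run through all basis columns, so their values determine every entry. *)
Lemma structure_vector_inj (M M' : 'rV[R]_(\prod_(i < n) k i)) :
  (forall x, (M *m profile_vec R x) 0 0 = (M' *m profile_vec R x) 0 0) ->
  M = M'.
Proof.
move=> eqM; apply/rowP=> a; have [x <-] := profile_index_surj a.
by have := eqM x; rewrite profile_vecE -!colE !mxE.
Qed.

(* x_j survives for j \in A; the other factors of Gamma_A have a single row. *)
Definition drawn_strategy A x i : 'I_(if i \in A then k i else 1%N) :=
  if i \in A as b return 'I_(if b then k i else 1%N) then x i else ord0.

Definition drawn_index A x : 'I_(\prod_(i in A) k i) :=
  cast_ord (esym (big_mkcond _ _)) (kron_index (drawn_strategy A x)).

Lemma drawn_index_eq A x y :
  drawn_index A x = drawn_index A y <-> {in A, forall j, x j = y j}.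
Proof.
rewrite /drawn_index; split=> [/cast_ord_inj/kron_index_inj eq_xy j|eq_xy].
  by have := eq_xy j; rewrite /drawn_strategy; case: (j \in A).
congr cast_ord; apply/kron_index_inj=> j; rewrite /drawn_strategy.
by have := eq_xy j; case: (j \in A) => // ->.
Qed.

(** By the mixed-product rule [kron_mul] it suffices to treat each factor: the identity keeps $x_i$,
    and an all-ones row sends a basis vector to the scalar 1. *)
Lemma drawing_mxE A x :
  drawing_matrix R k A *m profile_vec R x = delta_mx (drawn_index A x) 0.
Proof.
rewrite /drawing_matrix /profile_vec mul_castmx kron_mul.
rewrite (@eq_kron _ _ _ _ _ (fun i => delta_mx (drawn_strategy A x i) ord0)).
  rewrite kron_delta; apply/colP=> i; rewrite castmxE !mxE esymK [in RHS]eqxx.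
  rewrite /drawn_index; set e := big_mkcond _ _.
  have -> : (i == cast_ord (esym e) (kron_index (drawn_strategy A x)))
          = (cast_ord e i == kron_index (drawn_strategy A x)).
    by rewrite -(inj_eq (@cast_ord_inj _ _ e)) cast_ordKV.
  congr ((_ && _)%:R); rewrite -(inj_eq (@cast_ord_inj _ _ (big1_eq _ _))).
  by rewrite !ord1.
move=> i; rewrite /drawing_factor /drawn_strategy /strategy_vec.
case: (i \in A); first by rewrite mul1mx.
by apply/matrixP=> a b; rewrite -colE !mxE !ord1.
Qed.

Lemma mul_drawing_mxE A (xi : 'cV[R]_(\prod_(i in A) k i)) x :
  (xi^T *m drawing_matrix R k A *m profile_vec R x) 0 0
    = xi (drawn_index A x) 0.
Proof. by rewrite -mulmxA drawing_mxE -colE !mxE. Qed.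

Lemma depends_only_onP A (f : profile k -> R) :
  depends_only_on A f <->
  exists xi : 'cV[R]_(\prod_(i in A) k i),
    forall x, f x = (xi^T *m drawing_matrix R k A *m profile_vec R x) 0 0.
Proof.
split=> [fA|[xi fE] x y eq_xy]; last first.
  by rewrite !fE !mul_drawing_mxE; congr (xi _ 0); apply/drawn_index_eq.
(* Any profile with drawn index [a] will do, since [f] sees only its coordinates in [A]. The default
   0 sits at indices that no profile reaches. *)
exists (\col_a if [pick x | drawn_index A x == a] is Some x then f x else 0).
move=> x; rewrite mul_drawing_mxE mxE.
case: pickP => [y /eqP/drawn_index_eq eq_yx|/(_ x)]; last by rewrite eqxx.
by apply: fA => j /eq_yx.
Qed.

(** Transposing turns the equation into one between row vectors, which can be tested on profile
    vectors. *)
Lemma T_mx_eqP (U : 'I_n -> {set 'I_n}) (phi : profile k -> R) V i xi1 xi2 :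
  is_structure_vector phi V ->
  T_mx R k U i *m col_mx xi1 xi2 = V^T <->
  forall x, phi x
    = (xi1^T *m drawing_matrix R k (closed_nbhd U i) *m profile_vec R x) 0 0
      + (xi2^T *m drawing_matrix R k [set~ i] *m profile_vec R x) 0 0.
Proof.
move=> phiE; rewrite /T_mx mul_row_col.
split=> [eqT x|phi_split].
  by rewrite phiE -[V]trmxK -eqT linearD /= !trmx_mul !trmxK mulmxDl mxE.
apply: trmx_inj; rewrite trmxK linearD /= !trmx_mul !trmxK.
by apply: structure_vector_inj => x; rewrite mulmxDl mxE -phi_split phiE.
Qed.

Lemma play_id x i : play x (x i) = x.
Proof.
apply/ffunP=> j; rewrite ffunE.
by have [<-|neq_ij] := eqVneq i j; rewrite ?dfwith_in ?dfwith_out.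
Qed.

Lemma potential_depends_only_on (c : 'I_n -> profile k -> R) P :
  is_potential_game c P <->
  forall i, depends_only_on [set~ i] (fun x => P x - c i x).
Proof.
split=> [cP i x y eq_xy|indep i s a b].
  (* Agreement off [i] makes [y] a unilateral deviation of player [i] from [x]. *)
  have -> : y = play x (y i).
    apply/ffunP=> j; rewrite ffunE.
    have [<-|neq_ij] := eqVneq i j; rewrite ?dfwith_in ?dfwith_out //.
    by rewrite eq_xy // !inE eq_sym.
  have := cP i x (x i) (y i); rewrite play_id => eq_c.
  lra.
suff: P (play s a) - c i (play s a) = P (play s b) - c i (play s b) by lra.
apply: indep => j; rewrite !inE eq_sym => neq_ij.
by rewrite !ffunE !dfwith_out.
Qed.

End Drawing.

Theorem theorem3p1 (R : realType) (n : nat) (k : 'I_n -> nat)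
    (U : 'I_n -> {set 'I_n}) (phi : profile k -> R)
    (V : 'rV[R]_(\prod_(i < n) k i)) (hV : is_structure_vector phi V) :
  (local_info_designable U phi <->
   forall i : 'I_n,
     exists (xi1 : 'cV[R]_(\prod_(j in closed_nbhd U i) k j))
            (xi2 : 'cV[R]_(\prod_(j in [set~ i]) k j)),
       T_mx R k U i *m col_mx xi1 xi2 = V^T)
  /\
  (forall (xi1 : forall i : 'I_n, 'cV[R]_(\prod_(j in closed_nbhd U i) k j))
          (xi2 : forall i : 'I_n, 'cV[R]_(\prod_(j in [set~ i]) k j)),
     (forall i : 'I_n, T_mx R k U i *m col_mx (xi1 i) (xi2 i) = V^T) ->
     local_info_utilities U phi
       (fun (i : 'I_n) (x : profile k) =>
          ((xi1 i)^T *m drawing_matrix R k (closed_nbhd U i)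
             *m profile_vec R x) 0 0)).
Proof.
(* The explicit formula comes first: it is the second claim and also yields the converse half of the
   equivalence. *)
have design xi1 xi2 :
    (forall i : 'I_n, T_mx R k U i *m col_mx (xi1 i) (xi2 i) = V^T) ->
    local_info_utilities U phi (fun i x =>
      ((xi1 i)^T *m drawing_matrix R k (closed_nbhd U i)
         *m profile_vec R x) 0 0).
  move=> solved; split=> [i|].
    by apply/depends_only_onP; exists (xi1 i).
  apply/potential_depends_only_on=> i; apply/depends_only_onP; exists (xi2 i).
  (* Subtracting $c_i$ from [phi] leaves exactly the [xi2] summand. *)
  by move=> x; rewrite ((T_mx_eqP _ _ hV).1 (solved i)) addrAC subrr add0r.
split=> //; split=> [[c [c_local c_pot]] i|solvable].
  have /depends_only_onP[xi1 cE] := c_local i.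
  have /depends_only_onP[xi2 restE] :=
    (potential_depends_only_on _ _).1 c_pot i.
  exists xi1, xi2; apply/(T_mx_eqP _ _ hV)=> x.
  by rewrite -cE -restE addrC subrK.
(* Finite choice over the players gathers the separate solutions into families. *)
have [xi1 xi1P] := fin_all_exists solvable.
have [xi2 xi2P] := fin_all_exists xi1P.
by eexists; apply: design xi2P.
Qed.
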